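(* Let $\mathcal{G}=\langle a,b\rangle\le \mathrm{Aut}(T)$ be the second Grigorchuk group acting on the $4$-adic tree $T$. Then the following hold: (i) the group $\mathcal{G}$ is super strongly fractal; (ii) the automorphism group $\mathrm{Aut}(\mathcal{G})$ of $\mathcal{G}$ equals the normaliser $N_{\mathrm{Aut}(T)}(\mathcal{G})$ of $\mathcal{G}$ in $\mathrm{Aut}(T)$.
   Context: Let $X=\{1,2,3,4\}$ and let $T$ be the $4$-adic (regular rooted) tree whose vertices are identified with the words in the free monoid $X^*$: the root is the empty word, and each word $\omega$ is joined by an edge to $\omega x$ for each $x\in X$. The words of length $n$ form the $n$th level (layer). $\mathrm{Aut}(T)$ is the group of automorphisms of $T$ (fixing the root), acting on the right. For $f\in\mathrm{Aut}(T)$ and a vertex $u$, the section $f_u\in\mathrm{Aut}(T)$ is defined by $(uv)^f=u^f v^{f_u}$ for all $v\in X^*$. For a subgroup $H\le\mathrm{Aut}(T)$, $\mathrm{St}_H(n)$ is the $n$th level stabiliser, i.e. the subgroup of elements of $H$ fixing every vertex of level $n$, and $\mathrm{St}_H(u)$ is the stabiliser in $H$ of the vertex $u$. The map $\psi:\mathrm{St}_{\mathrm{Aut}(T)}(1)\to\mathrm{Aut}(T)^4$, $\psi(f)=(f_1,f_2,f_3,f_4)$, is an isomorphism. The second Grigorchuk group is $\mathcal{G}=\langle a,b\rangle\le\mathrm{Aut}(T)$, where $a$ is the rooted automorphism corresponding to the cycle $(1\ 2\ 3\ 4)$ (that is, $(xv)^a=x^{(1\,2\,3\,4)}v$ for $x\in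 X$, $v\in X^*$), and $b\in\mathrm{St}_{\mathrm{Aut}(T)}(1)$ is recursively defined by $\psi(b)=(a,1,a,b)$. For $\omega\in X^*$, let $\varphi_\omega:\mathrm{St}_{\mathrm{Aut}(T)}(\omega)\to\mathrm{Aut}(T)$, $f\mapsto f_\omega$, be the section map. A group $G\le\mathrm{Aut}(T)$ is super strongly fractal if, for each $n\in\mathbb{N}$, $\varphi_\omega(\mathrm{St}_G(n))=G$ for every word $\omega\in X^*$ of length $n$. The equality $\mathrm{Aut}(\mathcal{G})=N_{\mathrm{Aut}(T)}(\mathcal{G})$ is understood via conjugation: the natural homomorphism $N_{\mathrm{Aut}(T)}(\mathcal{G})\to\mathrm{Aut}(\mathcal{G})$ sending $h$ to the automorphism $g\mapsto g^h=h^{-1}gh$ of $\mathcal{G}$ is bijective. *)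

(* Defs.v *)
Set Warnings "-notation-overridden,-redundant-canonical-projection,-projection-no-head-constant".
From HB Require Import structures.
From mathcomp Require Import all_boot.
From mathcomp Require Import boolp classical_sets.

Set Implicit Arguments.
Unset Strict Implicit.
Unset Printing Implicit Defensive.

Local Open Scope classical_set_scope.
Local Open Scope group_scope.

(* Groups are `groupType`s (not necessarily finite); a subgroup of `gT` is a
   predicate in `groupClosed gT`.  All actions are on the right, so that
   `f * g` acts as `f` followed by `g`, and `x ^ y = y^-1 * x * y`. *)

Definition sym (T : choiceType) := {f : T -> T | `[< bijective f >]}.

HB.instance Definition _ (T : choiceType) := SubChoice.on (sym T).

Section Sym.
Variable T : choiceType.
Implicit Types f g : sym T.

Definition sym_fun f : T -> T := val f.

Definition Sym (h : T -> T) (hb : bijective h) : sym T := Sub h (asboolT hb).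

Lemma sym_bij f : bijective (sym_fun f).
Proof. exact: (asboolW (valP f)). Qed.

Lemma symP f g : sym_fun f =1 sym_fun g -> f = g.
Proof. by move=> fg; apply/val_inj/funext. Qed.

Lemma sym_has_inv f :
  exists h, cancel (sym_fun f) h /\ cancel h (sym_fun f).
Proof. by case: (sym_bij f) => h; exists h. Qed.

Definition sym_ifun f : T -> T := projT1 (cid (sym_has_inv f)).

Lemma sym_funK f : cancel (sym_fun f) (sym_ifun f).
Proof. by rewrite /sym_ifun; case: cid => h []. Qed.

Lemma sym_ifunK f : cancel (sym_ifun f) (sym_fun f).
Proof. by rewrite /sym_ifun; case: cid => h []. Qed.

Definition sym_one : sym T := Sym (Bijective (fun=> erefl) (fun=> erefl) : bijective id).
Definition sym_inv f : sym T := Sym (Bijective (sym_ifunK f) (sym_funK f)).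
Definition sym_mul f g : sym T := Sym (bij_comp (sym_bij g) (sym_bij f)).

Lemma sym_mulA : associative sym_mul.
Proof. by move=> f g h; apply: symP. Qed.
Lemma sym_mul1 : left_id sym_one sym_mul.
Proof. by move=> f; apply: symP. Qed.
Lemma sym_mulr1 : right_id sym_one sym_mul.
Proof. by move=> f; apply: symP. Qed.
Lemma sym_mulV : left_inverse sym_one sym_inv sym_mul.
Proof. by move=> f; apply: symP => x; apply: sym_ifunK. Qed.
Lemma sym_mulrV : right_inverse sym_one sym_inv sym_mul.
Proof. by move=> f; apply: symP => x; apply: sym_funK. Qed.

HB.instance Definition _ :=
  isGroup.Build (sym T) sym_mulA sym_mul1 sym_mulr1 sym_mulV sym_mulrV.

Lemma symM f g x : sym_fun (f * g) x = sym_fun g (sym_fun f x).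
Proof. by []. Qed.
Lemma sym1 x : sym_fun (1 : sym T) x = x.
Proof. by []. Qed.
Lemma symVK f x : sym_fun (f^-1) (sym_fun f x) = x.
Proof. exact: sym_funK. Qed.
Lemma symKV f x : sym_fun f (sym_fun (f^-1) x) = x.
Proof. exact: sym_ifunK. Qed.
Lemma sym_inj f : injective (sym_fun f).
Proof. exact: can_inj (symVK f). Qed.

End Sym.
Arguments sym_inj {T} f [x1 x2] : rename.

(* The coercion to `baseUMagmaType` in the first instance is needed: without it
   the `umagmaClosed` and `groupClosed` structures are not inferred. *)
HB.factory Record isGroupClosed (gT : groupType) (S : {pred gT}) := {
  group_closedP : group_closed S
}.
HB.builders Context gT S of isGroupClosed gT S.
HB.instance Definition _ := isMulClosed.Build (gT : baseUMagmaType) S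
  (group_closedM group_closedP).
HB.instance Definition _ := isMul1Closed.Build gT S (proj1 group_closedP).
HB.instance Definition _ := isInvClosed.Build gT S
  (group_closedV group_closedP).
HB.end.

Section Subgroups.
Variable gT : groupType.

Definition subg_of (H : groupClosed gT) := {x : gT | x \in H}.
HB.instance Definition _ (H : groupClosed gT) := SubChoice.on (subg_of H).
Lemma subg_closed (H : groupClosed gT) : group_closed (fun x => x \in H).
Proof.
split=> [|x y]; first exact: gpred1.
by move=> xH yH; apply: (gpredM (s := H)); rewrite ?gpredV.
Qed.
HB.instance Definition _ (H : groupClosed gT) :=
  SubChoice_isSubGroup.Build gT _ (subg_of H) (subg_closed H).

Definition generated (A : set gT) : {pred gT} :=
  fun x => `[< forall H : groupClosed gT, A `<=` [set` H] -> x \in H >].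

Definition normaliser (H : {pred gT}) : {pred gT} :=
  fun h => `[< [set g ^ h | g in [set` H]] = [set` H] >].

Lemma generatedP (A : set gT) x :
  reflect (forall H : groupClosed gT, A `<=` [set` H] -> x \in H)
          (x \in generated A).
Proof. exact: asboolP. Qed.

Lemma normaliserP (H : {pred gT}) h :
  reflect (forall g, (g ^ h \in H) = (g \in H)) (h \in normaliser H).
Proof.
apply: (iffP (asboolP _)) => [hH g | hH].
  apply/idP/idP => [ghH|gH].
    have : [set` H] (g ^ h) := ghH.
    by rewrite -hH => -[k kH /conjg_inj <-].
  have : [set g ^ h | g in [set` H]] (g ^ h) by exists g.
  by rewrite hH.
rewrite eqEsubset; split=> [_ [g gH <-]|g gH]; first by rewrite /= hH.
by exists (g ^ h^-1); rewrite /= ?conjgKV // -hH conjgKV.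
Qed.

Lemma generated_closed A : group_closed (generated A).
Proof.
split=> [|x y /generatedP xA /generatedP yA]; apply/generatedP => H AH.
  exact: gpred1.
by apply: gpredM; rewrite ?gpredV; [apply: xA | apply: yA].
Qed.

Lemma normaliser_closed H : group_closed (normaliser H).
Proof.
split=> [|x y /normaliserP xH /normaliserP yH]; apply/normaliserP => g.
  by rewrite conjg1.
by rewrite -[in RHS](xH g) -[in LHS]yH conjgM conjgKV.
Qed.

HB.instance Definition _ A :=
  isGroupClosed.Build gT (generated A) (generated_closed A).
HB.instance Definition _ H :=
  isGroupClosed.Build gT (normaliser H) (normaliser_closed H).

Definition aut_pred : {pred sym gT} :=
  fun f => `[< {morph sym_fun f : x y / x * y} >].

Lemma aut_predP f :
  reflect {morph sym_fun f : x y / x * y} (f \in aut_pred).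
Proof. exact: asboolP. Qed.

Lemma aut_pred_closed : group_closed aut_pred.
Proof.
split=> [|f g /aut_predP fM /aut_predP gM]; apply/aut_predP => x y //.
by rewrite !symM; apply: (sym_inj g); rewrite gM !symKV fM.
Qed.

HB.instance Definition _ :=
  isGroupClosed.Build (sym gT) aut_pred aut_pred_closed.

End Subgroups.
Arguments aut_pred : clear implicits.

Definition group_aut (K : groupType) := subg_of (aut_pred K : groupClosed (sym K)).
HB.instance Definition _ (K : groupType) := Group.on (group_aut K).

Section Conjugation.
Variables (gT : groupType) (H : groupClosed gT).

Definition norm_of := subg_of (normaliser H : groupClosed gT).
HB.instance Definition _ := Group.on norm_of.

Lemma norm_conj (h : norm_of) (g : subg_of H) : val g ^ val h \in H.
Proof. by have /normaliserP -> := valP h; apply: (valP g). Qed.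

Definition conj_fun (h : norm_of) (g : subg_of H) : subg_of H :=
  Sub (val g ^ val h) (norm_conj h g).

Lemma conj_fun_bij h : bijective (conj_fun h).
Proof.
by exists (conj_fun h^-1) => g; apply: val_inj => /=; rewrite ?conjgK ?conjgKV.
Qed.

Lemma conj_fun_aut h : Sym (conj_fun_bij h) \in aut_pred (subg_of H).
Proof. by apply/aut_predP => x y; apply: val_inj; rewrite /= conjMg. Qed.

Definition conj_aut (h : norm_of) : group_aut (subg_of H) :=
  Sub (Sym (conj_fun_bij h)) (conj_fun_aut h).

Lemma conj_autM : {morph conj_aut : h k / h * k}.
Proof.
move=> h k; apply/val_inj/symP => g; apply: val_inj.
by rewrite /= conjgM.
Qed.

HB.instance Definition _ := isMultiplicative.Build norm_of
  (group_aut (subg_of H)) conj_aut conj_autM.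

End Conjugation.
Arguments conj_aut {gT} H h.

(* The letters 1, 2, 3, 4 are the ordinals 0, 1, 2, 3 of `'I_4`. *)
Definition word := seq 'I_4.

(* The tree T is the graph on `word` with this adjacency, rooted at `[::]`. *)
Definition adjacent (u v : word) : Prop :=
  (exists x, v = rcons u x) \/ (exists x, u = rcons v x).

Definition tree_aut_pred : {pred sym word} := fun f =>
  `[< sym_fun f [::] = [::] /\
      forall u v, adjacent (sym_fun f u) (sym_fun f v) <-> adjacent u v >].

Lemma tree_aut_predP f :
  reflect (sym_fun f [::] = [::] /\
      forall u v, adjacent (sym_fun f u) (sym_fun f v) <-> adjacent u v)
    (f \in tree_aut_pred).
Proof. exact: asboolP. Qed.

Lemma tree_aut_closed : group_closed tree_aut_pred.
Proof.
split=> [|f g /tree_aut_predP[f0 fE] /tree_aut_predP[g0 gE]].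
  by apply/tree_aut_predP.
apply/tree_aut_predP; split=> [|u v]; rewrite !symM.
  by rewrite f0 -[X in sym_fun _ X]g0 symVK.
by rewrite -gE !symKV.
Qed.

HB.instance Definition _ :=
  isGroupClosed.Build (sym word) tree_aut_pred tree_aut_closed.

Definition tree_aut := subg_of (tree_aut_pred : groupClosed (sym word)).
HB.instance Definition _ := Group.on tree_aut.

Definition act (f : tree_aut) : word -> word := sym_fun (val f).

Lemma actP (f g : tree_aut) : act f =1 act g -> f = g.
Proof. by move=> fg; apply/val_inj/symP. Qed.
Lemma actM (f g : tree_aut) u : act (f * g) u = act g (act f u).
Proof. by []. Qed.
Lemma act1 u : act 1 u = u.
Proof. by []. Qed.
Lemma actVK (f : tree_aut) u : act f^-1 (act f u) = u.
Proof. exact: symVK. Qed.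
Lemma actKV (f : tree_aut) u : act f (act f^-1 u) = u.
Proof. exact: symKV. Qed.

Lemma act_inj (f : tree_aut) : injective (act f).
Proof. exact: sym_inj. Qed.
Arguments act_inj f [x1 x2] : rename.

Lemma act_rcons (f : tree_aut) u x :
  exists y, act f (rcons u x) = rcons (act f u) y.
Proof.
have /tree_aut_predP[f0 fE] := valP f.
have adj v z : adjacent (act f v) (act f (rcons v z)).
  by apply/fE; left; exists z.
elim/last_ind: u x => [|u z IHu] x.
  case: (adj [::] x) => -[y]; first by exists y.
  by rewrite /act f0; case: (sym_fun _ _).
case: (adj (rcons u z) x) => -[y]; first by exists y.
have [t ->] := IHu z => /rcons_inj[/act_inj/(congr1 size)].
by rewrite !size_rcons => /eqP; rewrite ltn_eqF // ltnS leqnSn.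
Qed.

Lemma size_act (f : tree_aut) u : size (act f u) = size u.
Proof.
elim/last_ind: u => [|u x IHu].
  by have /tree_aut_predP[f0 _] := valP f; rewrite /act f0.
by have [y ->] := act_rcons f u x; rewrite !size_rcons IHu.
Qed.

Lemma act_cat (f : tree_aut) u v :
  act f (u ++ v) = act f u ++ drop (size u) (act f (u ++ v)).
Proof.
rewrite -[LHS](cat_take_drop (size u)); congr (_ ++ _).
elim/last_ind: v => [|v x IHv].
  by rewrite cats0 -(size_act f) take_size.
rewrite -rcons_cat; have [y ->] := act_rcons f (u ++ v) x.
by rewrite -cats1 takel_cat // size_act size_cat leq_addr.
Qed.

Lemma tree_autE (f : sym word) :
  (forall u, size (sym_fun f u) = size u) ->
  (forall u v, exists w, sym_fun f (u ++ v) = sym_fun f u ++ w) ->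
  f \in tree_aut_pred.
Proof.
move=> fS fC; apply/tree_aut_predP; split=> [|u v].
  by apply/size0nil; rewrite fS.
have childE u' v' : (exists x, sym_fun f v' = rcons (sym_fun f u') x) <->
                    (exists x, v' = rcons u' x).
  split=> [[x fE]|[x ->]].
    have sz : size v' = (size u').+1 by rewrite -(fS v') fE size_rcons fS.
    case/lastP: v' sz fE => // v' y; rewrite size_rcons => -[sz].
    have [w] := fC v' [:: y]; rewrite cats1 => -> fE.
    exists y; congr rcons; apply: (sym_inj f).
    move/(congr1 (take (size v'))): fE; rewrite -{1}(fS v') take_size_cat //.
    by rewrite sz -cats1 -(fS u') take_size_cat.
  have [w fE] := fC u' [:: x].
  have := congr1 size fE; rewrite cats1 fS size_rcons size_cat fS -addn1.
  move/addnI; case: w fE => [|y []] // fE _.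
  by exists y; rewrite -!cats1.
by rewrite /adjacent !childE.
Qed.

(* Defined through (uv)^f = u^f v^{f_u}; see `sectionE`. *)
Definition section_fun (f : tree_aut) (u v : word) : word :=
  drop (size u) (act f (u ++ v)).

Lemma section_funE f u v : act f (u ++ v) = act f u ++ section_fun f u v.
Proof. exact: act_cat. Qed.

Lemma section_fun_bij f u : bijective (section_fun f u).
Proof.
exists (section_fun f^-1 (act f u)) => v.
  by rewrite {1}/section_fun -section_funE actVK drop_size_cat // size_act.
set w := section_fun _ _ v; rewrite /section_fun.
have -> : u ++ w = act f^-1 (act f u ++ v) by rewrite section_funE actVK.
by rewrite actKV drop_size_cat // size_act.
Qed.

Lemma section_fun_aut f u : Sym (section_fun_bij f u) \in tree_aut_pred.
Proof.
apply: tree_autE => [v|v w] /=.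
  by rewrite /section_fun /sym_fun /= size_drop size_act size_cat addKn.
exists (section_fun f (u ++ v) w).
rewrite /sym_fun /= {1}/section_fun catA section_funE section_funE -catA.
by rewrite drop_size_cat ?size_act.
Qed.

Definition section (f : tree_aut) (u : word) : tree_aut :=
  Sub (Sym (section_fun_bij f u)) (section_fun_aut f u).

Lemma sectionE f u v : act f (u ++ v) = act f u ++ act (section f u) v.
Proof. exact: section_funE. Qed.

Definition level_stab (H : {pred tree_aut}) (n : nat) : set tree_aut :=
  [set f | f \in H /\ forall u, size u = n -> act f u = u].

(* `section` is total; on `level_stab H n` with `size w = n` it restricts to the
   section homomorphism from the stabiliser of `w`. *)
Definition super_strongly_fractal (H : groupClosed tree_aut) : Prop :=
  forall (n : nat) (w : word), size w = n ->
    [set section f w | f in level_stab H n] = [set` H].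

Definition a_fun (w : word) : word :=
  if w is x :: v then ordS x :: v else [::].

Fixpoint b_fun (w : word) : word :=
  if w is x :: v then
    x :: match val x with
         | 0 => a_fun v
         | 1 => v
         | 2 => a_fun v
         | _ => b_fun v
         end
  else [::].

Lemma a_fun_bij : bijective a_fun.
Proof.
exists (fun w : word => if w is x :: v then ord_pred x :: v else [::]).
  by case=> //= x v; rewrite ordSK.
by case=> //= x v; rewrite ord_predK.
Qed.

Lemma b_fun_bij : bijective b_fun.
Proof.
have [a' aK a'K] := a_fun_bij.
exists (fix b' (w : word) : word := if w is x :: v then
    x :: match val x with 0 => a' v | 1 => v | 2 => a' v | _ => b' v end
  else [::]).
  by elim=> //= x v IHv; case: (val x) => [|[|[|?]]]; rewrite ?aK ?IHv.
by elim=> //= x v IHv; case: (val x) => [|[|[|?]]]; rewrite ?a'K ?IHv.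
Qed.

Lemma size_a_fun w : size (a_fun w) = size w.
Proof. by case: w. Qed.

Lemma a_fun_cat u v : exists w, a_fun (u ++ v) = a_fun u ++ w.
Proof. by case: u => [|x u]; [exists (a_fun v) | exists v]. Qed.

Lemma a_fun_aut : Sym a_fun_bij \in tree_aut_pred.
Proof.
by apply: tree_autE => [u|u v]; [apply: size_a_fun | apply: a_fun_cat].
Qed.

Lemma b_fun_aut : Sym b_fun_bij \in tree_aut_pred.
Proof.
apply: tree_autE; rewrite /sym_fun /=.
  by elim=> //= x v IHv; case: (val x) => [|[|[|?]]];
    rewrite ?size_a_fun ?IHv.
elim=> [|x u IHu] v; first by exists (b_fun v).
have [w1 E1] := a_fun_cat u v; have [w2 E2] := IHu v.
by rewrite /=; case: (val x) => [|[|[|?]]]; rewrite ?E1 ?E2;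
  [exists w1 | exists v | exists w1 | exists w2].
Qed.

Definition grig_a : tree_aut := Sub (Sym a_fun_bij) a_fun_aut.
Definition grig_b : tree_aut := Sub (Sym b_fun_bij) b_fun_aut.

(* That is, psi(b) = (a, 1, a, b). *)
Lemma psi_grig_b :
  [/\ forall x : 'I_4, act grig_b [:: x] = [:: x],
      section grig_b [:: inord 0] = grig_a,
      section grig_b [:: inord 1] = 1,
      section grig_b [:: inord 2] = grig_a
    & section grig_b [:: inord 3] = grig_b].
Proof.
split=> [x||||]; first by rewrite /act /sym_fun /=; case: (val x) => [|[|[|?]]].
all: apply: actP => v; rewrite /act /sym_fun /= /section_fun /act /sym_fun /=.
all: by rewrite inordK //= drop0.
Qed.

Definition grigorchuk2 : groupClosed tree_aut :=
  generated [set grig_a; grig_b].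

(* Main.v *)
Require Import Defs.
From mathcomp Require Import ssrfun.
From HB Require Import structures.
From mathcomp Require Import all_boot boolp classical_sets.

(** Write G for the group, D for its first level stabiliser, G' for its derived
    subgroup and K for gamma_3(G); a tuple (t0, t1, t2, t3) stands for the element
    of the first level stabiliser of Aut T with these sections.

    Everything rests on elements of D with prescribed sections.  Products,
    inverses and conjugates in the first level stabiliser are computed
    letterwise, so the first sections of the elements of G whose other sections
    have a suitable shape form a subgroup, and it is enough to treat the
    conjugates of b under the powers of a: this gives the lifts
    [lift_cyclic12], [lift_trivial3], [lift_diagonal02].  When two lifts commute
    at all letters but one, their commutator lives below that letter.  Hence K
    contains a copy of itself below every vertex ([gamma3_at_vertex]), and G
    contains a copy of the derived subgroup of D below the first letter
    ([stab_comm]).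

    Super strong fractality.  The quotient of two conjugates of b is
    (b, 1, b^-1, 1).  Since G contains the commutators of D placed below a letter,
    this propagates from b to its normal closure D: (z, 1, z^-1, 1) is in G for
    every z in D ([stab_mirror]).  If z fixes level n > 0, this element fixes level
    n + 1 and has z as a section; so the sections of St_G(n + 1) at a letter cover
    St_G(n), and induction on n starts from the fact that D has all of G as
    sections at each letter.

    Automorphisms.  The key is [commute_moved_letter]: if p moves some word
    beginning with x and q commutes with all G'-conjugates of p, then q fixes
    every word beginning with x.  Let phi be an automorphism of G and R_x the rigid
    stabiliser of the letter x.  The R_x commute pairwise and are normalised by D,
    which contains G'; so the four groups phi(R_x) are nontrivial, commute
    pairwise and are normalised by phi(D), which contains G' too.  By the key
    lemma no two of them move words below a common letter, so phi(R_x) moves words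
    below a single letter tau(x), and tau is a permutation.  As phi(D) normalises
    phi(R_x), it fixes tau(x), so phi(D) lies in D; and an element of D with trivial section at x
    commutes with R_x, so its image has trivial section at tau(x)
    ([aut_permutes_rigid]).  Consequently phi induces an automorphism phi_x of G
    with phi(d)_{tau(x)} = phi_x(d_x) for d in D.  The pair (tau(x), phi_x) is
    determined by phi, is multiplicative in phi, and is (x^g, conjugation by g_x)
    when phi is conjugation by g.  Therefore H(phi)(x v) = tau(x) H(phi_x)(v)
    defines a homomorphism H from Aut G to Aut T with H(conjugation by g) = g, and
    phi(g) = H(conjugation by phi(g)) = H(phi)^-1 g H(phi): every automorphism is
    conjugation by an element of the normaliser.  That element is unique because
    the centraliser of G in Aut T is trivial, again by the key lemma. *)

Set Implicit Arguments.
Unset Strict Implicit.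
Unset Printing Implicit Defensive.

Local Open Scope group_scope.

(** * Generated, derived and gamma_3 subgroups *)

Section Generation.
Variable gT : groupType.

Section InductionPredicate.
Variable P : gT -> Prop.
Hypotheses (P1 : P 1) (PM : forall x y, P x -> P y -> P (x * y))
  (PV : forall x, P x -> P x^-1).

Let S : {pred gT} := fun x => `[< P x >].

Let S_closed : group_closed S.
Proof.
split=> [|x y /asboolP Px /asboolP Py]; apply/asboolP => //.
by apply: PM => //; apply: PV.
Qed.

HB.instance Definition _ := isGroupClosed.Build gT S S_closed.

(** A property closed under the group operations is itself a subgroup, so it is
    one of the subgroups over which [generated] takes the intersection. *)
Lemma generated_ind (A : set gT) :
  (forall x, A x -> P x) -> forall x, x \in generated A -> P x.
Proof.
by move=> AP x /generatedP/(_ S) Ax; apply/asboolP/Ax => y Ay; apply/asboolP/AP.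
Qed.
End InductionPredicate.

Lemma mem_generated (A : set gT) x : A x -> x \in generated A.
Proof. by move=> Ax; apply/generatedP => H; apply. Qed.

Definition gamma3 (H : {pred gT}) : {pred gT} :=
  generated (fun k => exists x y z,
    [/\ x \in H, y \in H, z \in H & k = [~ [~ x, y], z]]).
Definition derived (H : {pred gT}) : {pred gT} :=
  generated (fun k => exists x y, [/\ x \in H, y \in H & k = [~ x, y]]).
HB.instance Definition _ (H : {pred gT}) := GroupClosed.on (gamma3 H).
HB.instance Definition _ (H : {pred gT}) := GroupClosed.on (derived H).

Lemma derived_mem (H : {pred gT}) x y :
  x \in H -> y \in H -> [~ x, y] \in derived H.
Proof. by move=> xH yH; apply: mem_generated; exists x, y. Qed.

Lemma derived_ind (H : {pred gT}) (P : gT -> Prop) :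
  P 1 -> (forall x y, P x -> P y -> P (x * y)) -> (forall x, P x -> P x^-1) ->
  (forall x y, x \in H -> y \in H -> P [~ x, y]) ->
  forall k, k \in derived H -> P k.
Proof.
move=> P1 PM PV PR k; apply: generated_ind => // _ [x [y [xH yH ->]]]; exact: PR.
Qed.

Lemma derived_sub (H : groupClosed gT) k : k \in derived H -> k \in H.
Proof.
move: k; apply: derived_ind.
- exact: gpred1.
- by move=> x y; apply: gpredM.
- by move=> x; rewrite gpredV.
- by move=> x y; apply: gpredR.
Qed.

Lemma derivedJ (H : groupClosed gT) k g :
  k \in derived H -> g \in H -> k ^ g \in derived H.
Proof.
move=> kH gH; move: k kH; apply: derived_ind.
- by rewrite conj1g gpred1.
- by move=> x y xH yH; rewrite conjMg gpredM.
- by move=> x xH; rewrite conjVg gpredV.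
- by move=> x y xH yH; rewrite !conjRg derived_mem ?gpredJ.
Qed.

Lemma gamma3_mem (H : {pred gT}) x y z :
  x \in H -> y \in H -> z \in H -> [~ [~ x, y], z] \in gamma3 H.
Proof. by move=> xH yH zH; apply: mem_generated; exists x, y, z. Qed.

Lemma gamma3_ind (H : {pred gT}) (P : gT -> Prop) :
  P 1 -> (forall x y, P x -> P y -> P (x * y)) -> (forall x, P x -> P x^-1) ->
  (forall x y z, x \in H -> y \in H -> z \in H -> P [~ [~ x, y], z]) ->
  forall k, k \in gamma3 H -> P k.
Proof.
move=> P1 PM PV PR k; apply: generated_ind => // _ [x [y [z [xH yH zH ->]]]].
exact: PR.
Qed.

Lemma gamma3J (H : groupClosed gT) k g :
  k \in gamma3 H -> g \in H -> k ^ g \in gamma3 H.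
Proof.
move=> kH gH; move: k kH; apply: gamma3_ind.
- by rewrite conj1g gpred1.
- by move=> x y xH yH; rewrite conjMg gpredM.
- by move=> x xH; rewrite conjVg gpredV.
- by move=> x y z xH yH zH; rewrite !conjRg gamma3_mem ?gpredJ.
Qed.

Lemma gamma3_derived (H : groupClosed gT) k : k \in gamma3 H -> k \in derived H.
Proof.
move: k; apply: gamma3_ind.
- exact: gpred1.
- by move=> x y; apply: gpredM.
- by move=> x; rewrite gpredV.
- by move=> x y z xH yH zH; rewrite derived_mem ?gpredR.
Qed.

Lemma commuteJ (x y g : gT) : commute x (y ^ g^-1) -> commute (x ^ g) y.
Proof. by move=> xy; rewrite /commute -{1 2}(conjgKV g y) -!conjMg xy. Qed.
End Generation.

(** * First level decomposition of tree automorphisms *)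

Section Act.
Implicit Types (f g p q k l : tree_aut) (u v w : word) (x y : 'I_4).

Definition letter f x : 'I_4 := head x (act f [:: x]).
Definition sec f x : tree_aut := section f [:: x].

Lemma act_nil f : act f [::] = [::].
Proof. by apply/size0nil; rewrite size_act. Qed.

Lemma act_cons f x v : act f (x :: v) = letter f x :: act (sec f x) v.
Proof.
rewrite -[x :: v]/([:: x] ++ v) sectionE /letter.
by have := size_act f [:: x]; case: (act f [:: x]) => [|y []].
Qed.

Lemma sec_unique f g x y :
  (forall v, act f (x :: v) = y :: act g v) -> letter f x = y /\ sec f x = g.
Proof.
move=> E; split; first by have := E [::]; rewrite act_cons => -[].
by apply: actP => v; have := E v; rewrite act_cons => -[].
Qed.

Lemma letterM f g x : letter (f * g) x = letter g (letter f x).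
Proof.
apply: (sec_unique (g := sec f x * sec g (letter f x)) _).1 => v.
by rewrite actM !act_cons.
Qed.

Lemma secM f g x : sec (f * g) x = sec f x * sec g (letter f x).
Proof.
apply: (sec_unique (y := letter g (letter f x)) _).2 => v.
by rewrite actM !act_cons.
Qed.

Lemma sec1 x : sec 1 x = 1.
Proof. by apply: (sec_unique (y := x) _).2 => v; rewrite !act1. Qed.

Lemma letterK f x : letter f^-1 (letter f x) = x.
Proof. by rewrite -letterM mulgV. Qed.
Lemma letterKV f x : letter f (letter f^-1 x) = x.
Proof. by rewrite -letterM mulVg. Qed.

Lemma secV f x : sec f^-1 (letter f x) = (sec f x)^-1.
Proof. by apply/(mulgI (sec f x)); rewrite -secM !mulgV sec1. Qed.

Lemma section_cons f x u : section f (x :: u) = section (sec f x) u.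
Proof.
apply: actP => v.
have := sectionE f (x :: u) v; rewrite cat_cons !act_cons sectionE => -[].
by move/eqP; rewrite eqseq_cat // eqxx => /eqP.
Qed.

Lemma section_nil f : section f [::] = f.
Proof.
by apply: actP => v; rewrite -[RHS]/(act f ([::] ++ v)) sectionE act_nil.
Qed.

Definition stab1 f := forall x, letter f x = x.

Lemma stab1M f g : stab1 f -> stab1 g -> stab1 (f * g).
Proof. by move=> f1 g1 x; rewrite letterM f1 g1. Qed.
Lemma stab1V f : stab1 f -> stab1 f^-1.
Proof. by move=> f1 x; rewrite -{1}(f1 x) letterK. Qed.
Lemma stab1J f g : stab1 f -> stab1 (f ^ g).
Proof. by move=> f1 x; rewrite !letterM f1 letterKV. Qed.

Lemma sec_stab1M f g x : stab1 f -> sec (f * g) x = sec f x * sec g x.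
Proof. by move=> f1; rewrite secM f1. Qed.
Lemma sec_stab1V f x : stab1 f -> sec f^-1 x = (sec f x)^-1.
Proof. by move=> f1; rewrite -secV f1. Qed.

Definition glue_fun (t : 'I_4 -> tree_aut) w : word :=
  if w is x :: v then x :: act (t x) v else [::].

Lemma glue_fun_bij t : bijective (glue_fun t).
Proof.
exists (glue_fun (fun x => (t x)^-1)) => -[|x v] //=; first by rewrite actVK.
by rewrite actKV.
Qed.

Lemma glue_fun_aut t : Sym (glue_fun_bij t) \in tree_aut_pred.
Proof.
apply: tree_autE => [[|x u]|[|x u] v] //=; first by rewrite size_act.
  by exists (glue_fun t v).
exists (act (section (t x) u) v).
by rewrite /sym_fun /= sectionE.
Qed.

(** The inverse of psi. *)
Definition glue t : tree_aut := Sub (Sym (glue_fun_bij t)) (glue_fun_aut t).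

Lemma act_glue t x v : act (glue t) (x :: v) = x :: act (t x) v.
Proof. by []. Qed.
Lemma letter_glue t x : letter (glue t) x = x. Proof. by []. Qed.
Lemma sec_glue t x : sec (glue t) x = t x.
Proof. exact: (sec_unique (y := x) _).2. Qed.

Lemma autE f g : letter f =1 letter g -> sec f =1 sec g -> f = g.
Proof.
move=> lE sE; apply: actP => -[|x v]; first by rewrite !act_nil.
by rewrite !act_cons lE sE.
Qed.

Lemma glueM s t : glue s * glue t = glue (fun x => s x * t x).
Proof. by apply: autE => x; rewrite ?letterM ?secM // !sec_glue. Qed.
Lemma glue1 : glue (fun=> 1) = 1.
Proof. by apply: autE => x; rewrite ?sec_glue ?sec1. Qed.
Lemma glueV t : (glue t)^-1 = glue (fun x => (t x)^-1).
Proof.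
apply: (mulgI (glue t)); rewrite mulgV glueM -glue1; congr glue.
by apply/funext => x; rewrite mulgV.
Qed.
Lemma glueJ s t : glue s ^ glue t = glue (fun x => s x ^ t x).
Proof. by rewrite /conjg glueV !glueM. Qed.
Lemma glueR s t : [~ glue s, glue t] = glue (fun x => [~ s x, t x]).
Proof. by rewrite /commg glueV glueJ glueM. Qed.

Definition glue4 t0 t1 t2 t3 := glue (fun x => nth 1 [:: t0; t1; t2; t3] x).

(** Letterwise identities about [glue] turn into identities about explicit
    4-tuples by rewriting with this. *)
Lemma glue4E t : glue t = glue4 (t ord0) (t (lift ord0 ord0))
  (t (lift ord0 (lift ord0 ord0))) (t (lift ord0 (lift ord0 (lift ord0 ord0)))).
Proof.
by congr glue; apply/funext => -[[|[|[|[|//]]]] i4] /=; congr t; apply: val_inj.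
Qed.

Lemma glue4M s0 s1 s2 s3 t0 t1 t2 t3 :
  glue4 s0 s1 s2 s3 * glue4 t0 t1 t2 t3 =
  glue4 (s0 * t0) (s1 * t1) (s2 * t2) (s3 * t3).
Proof. by rewrite glueM glue4E. Qed.
Lemma glue4V t0 t1 t2 t3 : (glue4 t0 t1 t2 t3)^-1 = glue4 t0^-1 t1^-1 t2^-1 t3^-1.
Proof. by rewrite glueV glue4E. Qed.
Lemma glue4J s0 s1 s2 s3 t0 t1 t2 t3 :
  glue4 s0 s1 s2 s3 ^ glue4 t0 t1 t2 t3 =
  glue4 (s0 ^ t0) (s1 ^ t1) (s2 ^ t2) (s3 ^ t3).
Proof. by rewrite glueJ glue4E. Qed.
Lemma glue4R s0 s1 s2 s3 t0 t1 t2 t3 :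
  [~ glue4 s0 s1 s2 s3, glue4 t0 t1 t2 t3] =
  glue4 [~ s0, t0] [~ s1, t1] [~ s2, t2] [~ s3, t3].
Proof. by rewrite glueR glue4E. Qed.
Lemma glue4_1 : glue4 1 1 1 1 = 1.
Proof. by rewrite -[RHS]glue1 glue4E. Qed.

End Act.

(** * Generators of the group and lifts of its elements to the first level *)

Local Notation a := grig_a.
Local Notation b := grig_b.
Local Notation G := grigorchuk2.

Lemma letter_a x : letter a x = ordS x. Proof. by []. Qed.
Lemma sec_a x : sec a x = 1.
Proof. exact: (sec_unique (y := ordS x) _).2. Qed.

Lemma b_glue4 : b = glue4 a 1 a b.
Proof.
have [bx _ _ _ _] := psi_grig_b.
by apply: actP => -[|[[|[|[|[|//]]]] i4] v].
Qed.

Lemma ordS4 (x : 'I_4) : ordS (ordS (ordS (ordS x))) = x.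
Proof. by apply: val_inj; case: x => [[|[|[|[|//]]]] i4]. Qed.

Lemma a_order4 : a ^+ 4 = 1.
Proof.
apply: autE => x; first by rewrite !letterM !letter_a ordS4.
by rewrite !secM !sec_a !mulg1 sec1.
Qed.

(** Conjugation by a rotates the sections, which reduces statements about an
    arbitrary letter to the first one. *)
Lemma glue4Ja t0 t1 t2 t3 : glue4 t0 t1 t2 t3 ^ a = glue4 t3 t0 t1 t2.
Proof.
rewrite /conjg; apply: (mulgI a); rewrite mulVKg; apply: autE => x.
  by rewrite !letterM letter_glue.
rewrite !secM !letter_glue !sec_a !sec_glue mulg1 mul1g.
by case: x => [[|[|[|[|//]]]] i4].
Qed.

Lemma a_in_G : a \in G. Proof. by apply: mem_generated; left. Qed.
Lemma b_in_G : b \in G. Proof. by apply: mem_generated; right. Qed.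
#[local] Hint Resolve a_in_G b_in_G : core.

Lemma G_ind (P : tree_aut -> Prop) :
  P 1 -> P a -> P b -> (forall x y, P x -> P y -> P (x * y)) ->
  (forall x, P x -> P x^-1) -> forall g, g \in G -> P g.
Proof. by move=> P1 Pa Pb PM PV g; apply: generated_ind => // _ [->|->]. Qed.

Lemma rot_ind (P : 'I_4 -> Prop) :
  P ord0 -> (forall x, P x -> P (ordS x)) -> forall x, P x.
Proof.
move=> P0 PS x.
have E (m : nat) : m < 4 -> P (inord m).
  elim: m => [|m IHm] m4.
    by rewrite (_ : inord 0 = ord0) //; apply: val_inj; rewrite /= inordK.
  rewrite (_ : inord m.+1 = ordS (inord m)); first by apply/PS/IHm/ltnW.
  by apply: val_inj; rewrite /= !inordK ?modn_small // ltnW.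
by rewrite -(inord_val x); apply: E.
Qed.

Local Notation C := (generated [set a]%classic).

Lemma cyc_a c : c \in C -> exists2 n, n < 4 & c = a ^+ n.
Proof.
suff: c \in C -> exists n, c = a ^+ n.
  move=> H /H[n ->]; exists (n %% 4); first by rewrite ltn_mod.
  by rewrite {1}(divn_eq n 4) expgnDr mulnC expgnA a_order4 expg1n mul1g.
move: c; apply: generated_ind => [|_ _ [n ->] [m ->]|_ [n ->]|_ ->].
- by exists 0.
- by exists (n + m)%N; rewrite expgnDr.
- exists (n * 3)%N; apply: (mulgI (a ^+ n)).
  by rewrite mulgV -expgnDr -mulnS mulnC expgnA a_order4 expg1n.
- by exists 1%N.
Qed.

Lemma cyc_a_comm c d : c \in C -> d \in C -> [~ c, d] = 1.
Proof.
by move=> /cyc_a[n _ ->] /cyc_a[m _ ->]; apply/eqP/commgP/commuteX2.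
Qed.

Lemma stab1_cyc_a c : c \in C -> stab1 c -> c = 1.
Proof.
move=> /cyc_a[n n4 ->] /(_ ord0); move: n n4.
by do 4![case=> //] => // n4; rewrite !letterM !letter_a => /(congr1 val).
Qed.

Lemma b_rot1 : glue4 b a 1 a \in G.
Proof. by rewrite -glue4Ja -b_glue4 gpredJ. Qed.
Lemma b_rot2 : glue4 a b a 1 \in G.
Proof. by rewrite -glue4Ja gpredJ ?b_rot1. Qed.
Lemma b_rot3 : glue4 1 a b a \in G.
Proof. by rewrite -glue4Ja gpredJ ?b_rot2. Qed.
Lemma b_rot0 : glue4 a 1 a b \in G.
Proof. by rewrite -b_glue4. Qed.
(** The conjugates of b by a and by a^3 have equal sections at the second and the
    fourth letter, so these cancel in the quotient. *)
Lemma b_mirror : glue4 b 1 b^-1 1 \in G.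
Proof.
have := gpredF b_rot1 b_rot3.
by rewrite glue4V glue4M invg1 mulg1 mul1g mulgV.
Qed.

(** Two such lifts commute at the two middle letters, since powers of a do. *)
Lemma lift_cyclic12 g : g \in G ->
  exists t1 t2 t3, [/\ glue4 g t1 t2 t3 \in G, t1 \in C & t2 \in C].
Proof.
have aC : a \in C by apply: mem_generated.
move: g; apply: G_ind.
- by exists 1, 1, 1; rewrite glue4_1 !gpred1.
- by exists 1, a, b; rewrite b_rot0 gpred1.
- by exists a, 1, a; rewrite b_rot1 gpred1.
- move=> x y [t1 [t2 [t3 [xG t1C t2C]]]] [s1 [s2 [s3 [yG s1C s2C]]]].
  by exists (t1 * s1), (t2 * s2), (t3 * s3); rewrite -glue4M !gpredM.
- move=> x [t1 [t2 [t3 [xG t1C t2C]]]].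
  by exists t1^-1, t2^-1, t3^-1; rewrite -glue4V !gpredV.
Qed.

Lemma lift_trivial3 g : g \in G -> exists t1 t2, glue4 g t1 t2 1 \in G.
Proof.
move: g; apply: G_ind.
- by exists 1, 1; rewrite glue4_1 gpred1.
- by exists b, a; rewrite b_rot2.
- by exists 1, b^-1; rewrite b_mirror.
- move=> x y [t1 [t2 xG]] [s1 [s2 yG]]; exists (t1 * s1), (t2 * s2).
  by have := gpredM _ _ xG yG; rewrite glue4M mulg1.
- move=> x [t1 [t2 xG]]; exists t1^-1, t2^-1.
  by have := xG; rewrite -gpredV glue4V invg1.
Qed.

(** The lift of b is the product of its two conjugates in which b occurs at the
    first and at the third letter. *)
Lemma lift_diagonal02 g : g \in G -> exists t1 t2, glue4 g t1 g t2 \in G.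
Proof.
move: g; apply: G_ind.
- by exists 1, 1; rewrite glue4_1 !gpred1.
- by exists 1, b; rewrite b_rot0.
- exists (a * a), (a * a).
  by have := gpredM _ _ b_rot1 b_rot3; rewrite glue4M mulg1 mul1g.
- move=> x y [t1 [t2 xG]] [s1 [s2 yG]].
  by exists (t1 * s1), (t2 * s2); rewrite -glue4M !gpredM.
- move=> x [t1 [t2 xG]].
  by exists t1^-1, t2^-1; rewrite -glue4V !gpredV.
Qed.

Definition at_letter x k := glue (fun y => if y == x then k else 1).

Lemma at_letter0 k : at_letter ord0 k = glue4 k 1 1 1.
Proof. by rewrite /at_letter glue4E. Qed.

Lemma glueJa t : glue t ^ a = glue (fun x => t (ord_pred x)).
Proof.
by rewrite !glue4E glue4Ja; congr glue4; congr t; exact: val_inj.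
Qed.

Lemma at_letterJa x k : at_letter x k ^ a = at_letter (ordS x) k.
Proof.
rewrite /at_letter glueJa; congr glue; apply/funext => y.
by rewrite -{2}(ord_predK y) (inj_eq (can_inj (@ordSK 4))).
Qed.

Lemma sec_a_conj f x : sec (f ^ a) (ordS x) = sec f x.
Proof.
rewrite -[ordS x]/(letter a x) /conjg secM letterK secV sec_a invg1 mul1g.
by rewrite secM sec_a mulg1.
Qed.

Lemma lift_at g x : g \in G -> exists f, [/\ f \in G, stab1 f & sec f x = g].
Proof.
move=> gG; elim/rot_ind: x => [|x [f [fG f1 fx]]].
  have [t1 [t2 fG]] := lift_diagonal02 gG.
  by exists (glue4 g t1 g t2); rewrite sec_glue.
exists (f ^ a); rewrite sec_a_conj gpredJ //; split=> //; exact: stab1J.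
Qed.

Lemma sec_G g x : g \in G -> sec g x \in G.
Proof.
move=> gG; move: g gG x; apply: G_ind => [x|x|x|g h gx hx x|g gx x].
- by rewrite sec1 gpred1.
- by rewrite sec_a gpred1.
- rewrite b_glue4 sec_glue; case: x => [[|[|[|[|//]]]] i4] //=; exact: gpred1.
- by rewrite secM gpredM.
- by rewrite -(letterKV g x) secV gpredV.
Qed.

Lemma section_G g u : g \in G -> section g u \in G.
Proof.
by elim: u g => [|x u IHu] g gG; rewrite ?section_nil // section_cons IHu ?sec_G.
Qed.

Lemma letter_trans x y : exists2 g, g \in G & letter g x = y.
Proof.
have H z : exists2 g, g \in G & letter g ord0 = z.
  elim/rot_ind: z => [|z [g gG gz]]; first by exists 1; rewrite ?gpred1.
  by exists (g * a); rewrite ?gpredM // letterM gz.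
have [g gG <-] := H x; have [h hG <-] := H y.
by exists (g^-1 * h); rewrite ?gpredM ?gpredV // letterM letterK.
Qed.

(** The rotation h carries x to y; the lift chosen first also undoes the section
    of h, so that only the tail remains to be moved. *)
Lemma level_trans u v : size u = size v -> exists2 g, g \in G & act g u = v.
Proof.
elim: u v => [|x u IHu] [|y v] //=; first by exists 1; rewrite ?gpred1.
have [h hG <-] := letter_trans x y; case=> uv.
have [g gG gu] : exists2 g, g \in G & act g u = act (sec h x)^-1 v.
  by apply: IHu; rewrite size_act.
have [f [fG f1 fx]] := lift_at x gG.
by exists (f * h); rewrite ?gpredM // actM act_cons f1 fx gu act_cons actKV.
Qed.

(** * Branching over gamma_3 *)

Local Notation K := (gamma3 G).

(** Lift x and y by sections in the powers of a at the middle letters, and z by a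
    trivial section at the last letter: then [~ [~ x', y'], z'] is trivial except
    at the first letter, where it is [~ [~ x, y], z]. *)
Lemma gamma3_at_letter0 k : k \in K -> at_letter ord0 k \in K.
Proof.
rewrite at_letter0; move: k; apply: gamma3_ind.
- by rewrite glue4_1 gpred1.
- by move=> x y xK yK; have := gpredM _ _ xK yK; rewrite glue4M !mulg1.
- by move=> x; rewrite -gpredV glue4V !invg1.
move=> x y z /lift_cyclic12[x1 [x2 [x3 [xG x1C x2C]]]].
move=> /lift_cyclic12[y1 [y2 [y3 [yG y1C y2C]]]] /lift_trivial3[z1 [z2 zG]].
have := gamma3_mem xG yG zG.
by rewrite !glue4R (cyc_a_comm x1C y1C) (cyc_a_comm x2C y2C) !comm1g commg1.
Qed.

Lemma gamma3_at_letter x k : k \in K -> at_letter x k \in K.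
Proof.
move=> kK; elim/rot_ind: x => [|x xK]; first exact: gamma3_at_letter0.
by rewrite -at_letterJa gamma3J.
Qed.

Fixpoint at_vertex (u : word) (k : tree_aut) : tree_aut :=
  if u is x :: u' then at_letter x (at_vertex u' k) else k.

Lemma gamma3_at_vertex u k : k \in K -> at_vertex u k \in K.
Proof. by elim: u => //= x u IHu /IHu/gamma3_at_letter. Qed.

Lemma act_at_vertex u k v : act (at_vertex u k) (u ++ v) = u ++ act k v.
Proof. by elim: u => //= x u IHu; rewrite act_glue eqxx IHu. Qed.

Lemma act_at_vertex_out u k w : ~~ prefix u w -> act (at_vertex u k) w = w.
Proof.
elim: u w => [|x u IHu] [|y w] //=.
by rewrite act_glue eq_sym; case: eqP => //= _ /IHu ->.
Qed.

(** * Super strong fractality *)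

(** The first level stabiliser of G is the normal closure of b: every element of G
    is a product of conjugates of b followed by a power of a, and a power of a
    that fixes a letter is trivial. *)
Lemma stab_ind (P : tree_aut -> Prop) :
  P 1 -> P b ->
  (forall x y, x \in G -> y \in G -> stab1 x -> stab1 y ->
    P x -> P y -> P (x * y)) ->
  (forall x, P x -> P x^-1) ->
  (forall x g, g \in G -> P x -> P (x ^ g)) ->
  forall z, z \in G -> stab1 z -> P z.
Proof.
move=> P1 Pb PM PV PJ.
have CG c : c \in C -> c \in G by case/cyc_a=> n _ ->; apply: gpredXn.
suff H z : z \in G ->
    exists d c, [/\ d \in G, stab1 d, P d, c \in C & z = d * c].
  move=> z /H[d [c [dG d1 Pd cC ->]]] dc1.
  rewrite (@stab1_cyc_a c) ?mulg1 // => x.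
  by rewrite -{1}(d1 x) -letterM dc1.
move: z; apply: G_ind.
- by exists 1, 1; rewrite ?gpred1 mulg1.
- by exists 1, a; rewrite ?gpred1 mul1g mem_generated.
- by exists b, 1; rewrite !gpred1 mulg1 b_in_G; split=> //; rewrite b_glue4.
- move=> _ _ [d [c [dG d1 Pd cC ->]]] [d' [c' [dG' d1' Pd' cC' ->]]].
  exists (d * d' ^ c^-1), (c * c'); split.
  + by rewrite gpredM // gpredJ // gpredV CG.
  + by apply/stab1M/stab1J.
  + apply: PM => //; last by apply: PJ => //; rewrite gpredV CG.
      by rewrite gpredJ // gpredV CG.
    exact: stab1J.
  + exact: gpredM.
  + by rewrite /conjg invgK !mulgA mulgVK.
- move=> _ [d [c [dG d1 Pd cC ->]]]; exists (d^-1 ^ c), c^-1; split.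
  + by apply: gpredJ; [rewrite gpredV | apply: CG].
  + by apply/stab1J/stab1V.
  + by apply/PJ/PV => //; apply: CG.
  + by rewrite gpredV.
  + by rewrite invgM /conjg !mulgA mulgK.
Qed.

Lemma stab_lift_trivial13 z : z \in G -> stab1 z ->
  exists t, glue4 z 1 t 1 \in G.
Proof.
move: z; apply: stab_ind.
- by exists 1; rewrite glue4_1 gpred1.
- by exists b^-1; apply: b_mirror.
- move=> x y _ _ _ _ [t xG] [s yG]; exists (t * s).
  by have := gpredM _ _ xG yG; rewrite glue4M mulg1.
- by move=> x [t xG]; exists t^-1; move: xG; rewrite -gpredV glue4V invg1.
- move=> x g /lift_cyclic12[t1 [t2 [t3 [gG _ _]]]] [t xG]; exists (t ^ t2).
  by have := gpredJ xG gG; rewrite glue4J !conj1g.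
Qed.

Lemma stab_lift_trivial2 z : z \in G -> stab1 z ->
  exists t1 t3, glue4 z t1 1 t3 \in G.
Proof.
move: z; apply: stab_ind.
- by exists 1, 1; rewrite glue4_1 gpred1.
- by exists a, a; apply: b_rot1.
- move=> x y _ _ _ _ [t1 [t3 xG]] [s1 [s3 yG]]; exists (t1 * s1), (t3 * s3).
  by have := gpredM _ _ xG yG; rewrite glue4M mulg1.
- move=> x [t1 [t3 xG]]; exists t1^-1, t3^-1.
  by move: xG; rewrite -gpredV glue4V invg1.
- move=> x g /lift_cyclic12[s1 [s2 [s3 [gG _ _]]]] [t1 [t3 xG]].
  exists (t1 ^ s1), (t3 ^ s3).
  by have := gpredJ xG gG; rewrite glue4J !conj1g.
Qed.

(** The two lifts have nontrivial sections at a common letter only at the first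
    one. *)
Lemma stab_comm z w : z \in G -> w \in G -> stab1 z -> stab1 w ->
  glue4 [~ z, w] 1 1 1 \in G.
Proof.
move=> zG wG z1 w1; have [t tG] := stab_lift_trivial13 zG z1.
have [s1 [s3 sG]] := stab_lift_trivial2 wG w1.
by have := gpredR tG sG; rewrite glue4R !comm1g commg1.
Qed.

(** The elements z with this property are closed under products because
    inversion is a homomorphism modulo commutators, which [stab_comm] corrects at
    the third letter; they are closed under conjugation thanks to lifts with equal
    sections at the first and third letters. *)
Lemma stab_mirror z : z \in G -> stab1 z -> glue4 z 1 z^-1 1 \in G.
Proof.
move: z; apply: stab_ind.
- by rewrite invg1 glue4_1 gpred1.
- exact: b_mirror.
- move=> x y xG yG x1 y1 xxG yyG.
  have cG : glue4 1 1 [~ y^-1, x^-1] 1 \in G.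
    by rewrite -glue4Ja -glue4Ja !gpredJ // stab_comm ?gpredV //; apply: stab1V.
  have := gpredM _ _ (gpredM _ _ xxG yyG) cG.
  by rewrite !glue4M !mulg1 -commgC -invgM.
- by move=> x xG; rewrite -{1}(invgK x) -gpredV glue4V !invgK invg1.
- move=> x g /lift_diagonal02[t1 [t2 gG]] xG.
  by have := gpredJ xG gG; rewrite glue4J !conj1g conjVg.
Qed.

Lemma stab_mirror_at x z : z \in G -> stab1 z ->
  exists t, [/\ glue t \in G, t x = z &
    forall y, [\/ t y = z, t y = z^-1 | t y = 1]].
Proof.
move=> zG z1; elim/rot_ind: x => [|x [t [tG tx ty]]].
  exists (fun x => nth 1 [:: z; 1; z^-1; 1] x); split=> //.
    exact: stab_mirror.
  by case=> [[|[|[|[|//]]]] i4] /=;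
    [apply: Or31|apply: Or33|apply: Or32|apply: Or33].
exists (fun y => t (ord_pred y)); rewrite -glueJa gpredJ // ordSK.
by split.
Qed.

Lemma level_stab_stab1 H n f : level_stab H n.+1 f -> stab1 f.
Proof.
case=> _ fix_n x.
have /fix_n : size (x :: nseq n x) = n.+1 by rewrite /= size_nseq.
by rewrite act_cons => -[].
Qed.

(** The induction starts at level 1, since an element of level stabiliser 0 need
    not fix the letters and [stab_mirror] applies only to those that do. *)
Lemma grigorchuk2_ssf : super_strongly_fractal G.
Proof.
move=> n w sz; apply/seteqP; split=> [_ [f [fG _] <-]|g gG] /=.
  exact: section_G.
elim: n w sz => [|n IHn] [|x v] //= sz.
  by exists g; rewrite ?section_nil //; split=> // -[]// _; rewrite act_nil.
case: sz => sz; case: n IHn sz => [|n] IHn sz.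
  have [f [fG f1 fx]] := lift_at x gG; exists f; last first.
    by rewrite section_cons (size0nil sz) section_nil.
  by split=> // -[|y [|]] // _; rewrite act_cons f1 act_nil.
have [z zS zv] := IHn v sz; have [zG zn] := zS.
have [t [tG tx ty]] := stab_mirror_at x zG (level_stab_stab1 zS).
exists (glue t); last by rewrite section_cons sec_glue tx.
split=> // -[|y u] //= [/zn zu]; rewrite act_glue.
by have [->|->|->] := ty y; rewrite ?act1 ?zu // -{1}zu actVK.
Qed.

(** * Commutation and supports *)

Lemma act_prefix q u v : act q (u ++ v) = u ++ v -> act q u = u.
Proof.
by rewrite sectionE => /eqP; rewrite eqseq_cat ?size_act // => /andP[/eqP].
Qed.

Lemma neq1_moves q : q <> 1 -> exists x u, act q (x :: u) <> x :: u.
Proof.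
move=> q1; apply: contrapT => H; apply/q1/actP => -[|x u].
  by rewrite act_nil.
by rewrite act1; apply: contrapT => xu; apply: H; exists x, u.
Qed.

Lemma disjoint_commute (f g : tree_aut) :
  (forall w, act f w = w \/ act g w = w) -> commute f g.
Proof.
have half (f' g' : tree_aut) w : (forall w, act f' w = w \/ act g' w = w) ->
    act f' w = w -> act (f' * g') w = act (g' * f') w.
  move=> H fw; rewrite !actM fw; have [-> //|gg] := H (act g' w).
  by rewrite (act_inj _ gg) fw.
move=> H; apply: actP => w; have [fw|gw] := H w; first exact: half.
by apply/esym/half => // v; have [] := H v; [right|left].
Qed.

Lemma at_vertexR u k l : [~ at_vertex u k, at_vertex u l] = at_vertex u [~ k, l].
Proof.
elim: u => //= x u <-; rewrite glueR; congr glue; apply/funext => y.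
by case: eqP; rewrite ?commg1.
Qed.

Lemma at_vertexV u k : (at_vertex u k)^-1 = at_vertex u k^-1.
Proof.
elim: u => //= x u <-; rewrite glueV; congr glue; apply/funext => y.
by case: eqP; rewrite ?invg1.
Qed.

(** The set of words moved by [at_vertex u m] is nonempty, lies below u and is
    preserved by everything that commutes with it. *)
Lemma commute_at_fix q u m : m <> 1 -> commute q (at_vertex u m) -> act q u = u.
Proof.
move=> /neq1_moves[x [t mt]] qm; set w := x :: t in mt.
have : prefix u (act q (u ++ w)).
  apply: contrapT => /negP/(act_at_vertex_out m).
  rewrite -actM qm actM act_at_vertex.
  by move/act_inj/eqP; rewrite eqseq_cat // eqxx => /eqP.
rewrite sectionE => /prefixP[v /eqP].
by rewrite eqseq_cat ?size_act // => /andP[/eqP].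
Qed.

Lemma ab_neq : a * b <> b * a.
Proof. by move/(congr1 (fun f => act f [:: ord0; ord0])) => -[]. Qed.

Lemma commg_ba : [~ b, a] = glue4 (a^-1 * b) a a^-1 (b^-1 * a).
Proof.
rewrite commgEl {2}b_glue4 glue4Ja {1}b_glue4 glue4V glue4M.
by rewrite invg1 mul1g mulg1.
Qed.

(** The first section of [~ [~ b, a], b] is [~ a^-1 * b, a], which is trivial only
    if a and b commute. *)
Lemma gamma3_neq1 : exists2 k, k \in K & k <> 1.
Proof.
exists [~ [~ b, a], b]; first exact: gamma3_mem.
rewrite commg_ba {3}b_glue4 glue4R => /(congr1 (sec^~ ord0)).
rewrite sec_glue sec1 /= => /eqP/commgP; rewrite /commute mulgA mulgV mul1g => E.
by apply: ab_neq; rewrite -[in LHS]E !mulgA mulgV mul1g.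
Qed.

(** If k moves u, it cannot commute with a copy of itself placed below u. *)
Lemma gamma3_nonabelian : exists k l, [/\ k \in K, l \in K & [~ k, l] <> 1].
Proof.
have [k kK k1] := gamma3_neq1; have [x [u xu]] := neq1_moves k1.
exists k, (at_vertex (x :: u) k); split=> //; first exact: gamma3_at_vertex.
by move/eqP/commgP/(commute_at_fix k1).
Qed.

Local Notation G' := (derived G).

(** The derived subgroup is large enough to have all of G as sections, so it can
    replace G in arguments that move subtrees around below a letter. *)
Lemma derived_lift_at g x : g \in G ->
  exists f, [/\ f \in G', stab1 f & sec f x = g].
Proof.
move=> gG; elim/rot_ind: x => [|x [f [fG f1 fx]]]; last first.
  exists (f ^ a); rewrite sec_a_conj derivedJ //; split=> //; exact: stab1J.
(* The sections of [~ b, a] include a and a^-1 * b, whose product is b. *)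
have cG : glue4 (a^-1 * b) a a^-1 (b^-1 * a) \in G'.
  by rewrite -commg_ba derived_mem.
have c3G : glue4 a a^-1 (b^-1 * a) (a^-1 * b) \in G'.
  by rewrite -glue4Ja -glue4Ja -glue4Ja !derivedJ.
move: g gG; apply: G_ind.
- by exists 1; rewrite gpred1 sec1.
- by exists (glue4 a a^-1 (b^-1 * a) (a^-1 * b)); rewrite sec_glue.
- have := gpredM _ _ c3G cG; rewrite glue4M mulgA mulgV mul1g => bG.
  by eexists; split; [exact: bG| |rewrite sec_glue].
- move=> x y [f [fG f1 <-]] [h [hG h1 <-]]; exists (f * h).
  by rewrite gpredM ?sec_stab1M //; split=> //; apply: stab1M.
- move=> x [f [fG f1 <-]]; exists f^-1.
  by rewrite gpredV ?sec_stab1V //; split=> //; apply: stab1V.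
Qed.

(** Take k and l supported below u ++ w.  As p moves u, the commutator of p and k
    is k times an element s supported away from u ++ w; conjugating it by l
    changes k only, so the quotient of the two is [~ k, l], supported below u ++ w.
    All elements formed on the way are products of G'-conjugates of p and their
    inverses, hence commute with q. *)
Lemma commute_moved_below (p q : tree_aut) u w :
  act p u <> u -> (forall g, g \in G' -> commute q (p ^ g)) ->
  act q (u ++ w) = u ++ w.
Proof.
move=> pu qp; have [k0 [l0 [k0K l0K kl1]]] := gamma3_nonabelian.
have := gamma3_derived (gamma3_at_vertex (u ++ w) k0K).
have := gamma3_derived (gamma3_at_vertex (u ++ w) l0K).
set k := at_vertex _ k0; set l := at_vertex _ l0 => lG kG.
have ls : commute l (k^-1 ^ p).
  apply: disjoint_commute => t.
  have [ut|nut] := boolP (prefix (u ++ w) t); last first.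
    by left; apply: act_at_vertex_out.
  right; rewrite !actM /k at_vertexV act_at_vertex_out ?actKV //.
  apply/negP => pt; apply: pu.
  case/prefixP: ut pt => ut ->; case/prefixP => v E.
  have := congr1 (act p) E; rewrite actKV -!catA !sectionE.
  by move/eqP; rewrite eqseq_cat ?size_act // => /andP[/eqP <-].
have qc : commute q [~ p, k].
  rewrite commgEl; apply: commuteM; last exact: qp.
  by apply: commuteV; rewrite -(conjg1 p); apply/qp/gpred1.
have qcl : commute q ([~ p, k] ^ l).
  rewrite conjRg commgEl -conjgM -conjgC; apply: commuteM; last exact/qp/gpredM.
  exact/commuteV/qp.
apply: (commute_at_fix kl1); rewrite -at_vertexR -/k -/l.
rewrite (_ : [~ k, l] = [~ p, k]^-1 * [~ p, k] ^ l).
  by apply: commuteM => //; apply: commuteV.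
have sl : (k^-1 ^ p) ^ l = k^-1 ^ p by rewrite [LHS]conjgE -ls mulKg.
by rewrite (commgEr p k) conjMg sl commgEl invgM -mulgA mulKg.
Qed.

(** The hypothesis on q is stable under conjugation by G', so the words fixed by q
    according to [commute_moved_below] can be moved around below x. *)
Lemma commute_moved_letter (p q : tree_aut) x u :
  act p (x :: u) <> x :: u -> (forall g, g \in G' -> commute q (p ^ g)) ->
  forall v, act q (x :: v) = x :: v.
Proof.
move=> pu qp v.
(* Padding v with u makes room for the prefix u at the image. *)
have [g gG gv] : exists2 g, g \in G & act g (v ++ u) = u ++ v.
  by apply: level_trans; rewrite !size_cat addnC.
have [f [fG f1 fx]] := derived_lift_at x gG.
have fE : act f ((x :: v) ++ u) = (x :: u) ++ v by rewrite /= act_cons f1 fx gv.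
apply: (@act_prefix q _ u); apply: (@act_inj f).
rewrite -{1}(actVK f (_ ++ u)) fE -!actM -/(q ^ f).
apply: commute_moved_below pu _ => h hG; apply/commuteJ.
by rewrite -conjgM; apply/qp/gpredM; rewrite ?gpredV.
Qed.

Lemma centraliser_trivial (p q : tree_aut) :
  p <> 1 -> (forall g, g \in G -> commute q (p ^ g)) -> q = 1.
Proof.
move=> /neq1_moves[x [u pu]] qp; apply: actP => -[|y v].
  by rewrite act_nil.
have [h hG hy] := letter_trans y x.
apply: (@act_inj h).
rewrite act1 -{1}(actVK h (y :: v)) (act_cons h) hy -!actM.
apply: (commute_moved_letter (q := h^-1 * (q * h)) pu) => g gG.
rewrite -/(q ^ h).
apply/commuteJ; rewrite -conjgM; apply: qp; rewrite gpredM ?gpredV //.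
exact: derived_sub.
Qed.

(** * Automorphisms of an abstract group as functions *)

Section AutApply.
Variable gT : groupType.
Implicit Types phi psi : group_aut gT.

Definition aut_fun phi : gT -> gT := sym_fun (val phi).

Lemma aut_funM phi : {morph aut_fun phi : g h / g * h}.
Proof. exact/aut_predP/(valP phi). Qed.
Lemma aut_fun_comp phi psi g :
  aut_fun (phi * psi) g = aut_fun psi (aut_fun phi g).
Proof. by []. Qed.
Lemma aut_fun_one g : aut_fun 1 g = g. Proof. by []. Qed.
Lemma aut_funK phi : cancel (aut_fun phi) (aut_fun phi^-1).
Proof. by move=> g; rewrite -aut_fun_comp mulgV. Qed.
Lemma aut_funVK phi : cancel (aut_fun phi^-1) (aut_fun phi).
Proof. by move=> g; rewrite -aut_fun_comp mulVg. Qed.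
Lemma aut_funP phi psi : aut_fun phi =1 aut_fun psi -> phi = psi.
Proof. by move=> E; apply/val_inj/symP. Qed.
Lemma aut_fun1 phi : aut_fun phi 1 = 1.
Proof. by apply: (mulgI (aut_fun phi 1)); rewrite -aut_funM !mulg1. Qed.
Lemma aut_funV phi : {morph aut_fun phi : g / g^-1}.
Proof.
move=> g; apply: (mulgI (aut_fun phi g)).
by rewrite -aut_funM !mulgV aut_fun1.
Qed.
Lemma aut_funJ phi : {morph aut_fun phi : g h / g ^ h}.
Proof. by move=> g h; rewrite /conjg !aut_funM aut_funV. Qed.
Lemma aut_funR phi : {morph aut_fun phi : g h / [~ g, h]}.
Proof. by move=> g h; rewrite /commg aut_funM aut_funJ aut_funV. Qed.

Definition aut_of (f : gT -> gT) (fb : bijective f)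
  (fM : {morph f : g h / g * h}) : group_aut gT :=
  Sub (Sym fb) (introT (aut_predP (Sym fb)) fM).

End AutApply.

(** * Images of rigid stabilisers *)

Local Notation GT := (subg_of G).
Implicit Types (phi : group_aut GT) (x y z : 'I_4) (r s d q g h : GT).

Lemma val_commute g h : commute (val g) (val h) <-> commute g h.
Proof.
split=> [gh|]; first by apply: val_inj.
by move/(congr1 val).
Qed.

Definition subsec g x : GT := Sub (sec (val g) x) (sec_G x (valP g)).

Lemma subsec_lift g x : exists2 d, stab1 (val d) & subsec d x = g.
Proof.
have [f [fG f1 fx]] := lift_at x (valP g).
by exists (Sub f fG); last exact: val_inj.
Qed.

(** On the first level G acts through the cyclic group generated by the rotation
    of the letters. *)
Lemma letter_comm (f : tree_aut) : f \in G -> forall g : tree_aut, g \in G ->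
  forall x, letter f (letter g x) = letter g (letter f x).
Proof.
have com (u : 'I_4 -> 'I_4) : (forall x, letter a (u x) = u (letter a x)) ->
    forall g : tree_aut, g \in G -> forall x, letter g (u x) = u (letter g x).
  move=> ua; apply: G_ind => // [k l ku lu x|k ku x].
  - by rewrite !letterM ku lu.
  - by rewrite -{1}(letterKV k x) -ku letterK.
by move=> fG g gG x; apply/esym/com => // {}x; apply/esym/com.
Qed.

Lemma derived_stab1 (k : tree_aut) : k \in G' -> stab1 k.
Proof.
move: k; apply: derived_ind => [//||k|k l kG lG x]; [exact: stab1M|exact: stab1V|].
by rewrite commgEl /conjg !letterM (letter_comm lG kG) !letterKV.
Qed.

Definition rigid x r := forall y v, y <> x -> act (val r) (y :: v) = y :: v.

Lemma rigid_neq1 x : exists r, [/\ r <> 1, stab1 (val r) & rigid x r].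
Proof.
have [k kK k1] := gamma3_neq1.
have kG := derived_sub (gamma3_derived (gamma3_at_letter x kK)).
exists (Sub (at_letter x k) kG); split=> //.
  by move/(congr1 (fun r => sec (val r) x)); rewrite /= sec_glue eqxx sec1.
by move=> y v yx; rewrite act_glue; case: eqP.
Qed.

Lemma rigidJ x r d : rigid x r -> stab1 (val d) -> rigid x (r ^ d).
Proof.
move=> rx d1 y v yx; rewrite /= 2!actM act_cons stab1V // rx //.
by rewrite -[RHS](actKV (val d)) (act_cons (val d)^-1) stab1V.
Qed.

Lemma rigid_commute x y r s : x <> y -> rigid x r -> rigid y s -> commute r s.
Proof.
move=> xy rx sy; apply/val_commute/disjoint_commute => -[|z v].
  by left; rewrite act_nil.
by have [zx|/eqP/rx] := eqVneq z x; [right; apply: sy; rewrite zx|left].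
Qed.

Lemma rigid_commute_sec x r d : rigid x r -> stab1 (val d) -> subsec d x = 1 ->
  commute d r.
Proof.
move=> rx d1 /(congr1 val)/= dx; apply/val_commute/disjoint_commute => -[|z v].
  by left; rewrite act_nil.
have [zx|/eqP/rx] := eqVneq z x; [left|by right].
by rewrite act_cons d1 zx dx.
Qed.

(** Both G' and its image under phi are the derived subgroup, and G' fixes the
    first level; this is how the conjugations by G' in [commute_moved_letter] are
    carried back through phi. *)
Lemma aut_fun_derived phi (k : tree_aut) : k \in G' ->
  exists2 d, stab1 (val d) & val (aut_fun phi d) = k.
Proof.
move: k; apply: derived_ind.
- by exists 1; rewrite ?aut_fun1.
- move=> _ _ [d d1 <-] [e e1 <-]; exists (d * e); last by rewrite aut_funM.
  exact: stab1M.
- move=> _ [d d1 <-]; exists d^-1; last by rewrite aut_funV.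
  exact: stab1V.
move=> k l kG lG; pose k' : GT := Sub k kG; pose l' : GT := Sub l lG.
exists [~ aut_fun phi^-1 k', aut_fun phi^-1 l']; last first.
  by rewrite aut_funR !aut_funVK.
by apply/derived_stab1/derived_mem; [apply: (valP (aut_fun _ k'))
                                   |apply: (valP (aut_fun _ l'))].
Qed.

(** Here tau x is a letter below which the image of the rigid stabiliser of x moves
    a word.  Images for different x commute, so they cannot move words below the
    same letter: tau is injective, hence bijective, and the image for x moves
    words below tau x only. *)
Lemma aut_permutes_rigid phi : exists tau : 'I_4 -> 'I_4,
  forall x d, stab1 (val d) -> stab1 (val (aut_fun phi d)) /\
    (subsec d x = 1 -> subsec (aut_fun phi d) (tau x) = 1).
Proof.
have [r rP] := choice rigid_neq1.
have rn x : exists y, exists v, act (val (aut_fun phi (r x))) (y :: v) <> y :: v.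
  apply: neq1_moves => E; have [r1 _ _] := rP x; apply: r1.
  by apply: (can_inj (aut_funK phi)); rewrite aut_fun1; apply: val_inj.
have [tau tauP] := choice rn.
have below x q : (forall s, rigid x s -> commute q s) ->
    forall v, act (val (aut_fun phi q)) (tau x :: v) = tau x :: v.
  move=> qs; have [u ru] := tauP x.
  apply: (commute_moved_letter ru) => k /(aut_fun_derived phi)[d d1 <-].
  rewrite -[val _ ^ val _]/(val (aut_fun phi (r x) ^ aut_fun phi d)) -aut_funJ.
  apply/val_commute; rewrite /commute -!aut_funM; congr (aut_fun phi _).
  by apply/qs/rigidJ => //; have [] := rP x.
have tau_inj : injective tau.
  move=> x x' txx'; apply: contrapT => xx'; have [u] := tauP x'; apply.
  rewrite -txx'; apply: below => s sx; apply: rigid_commute sx; last first.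
    by have [_ _] := rP x'; apply.
  exact/nesym.
have out x y s v : y <> tau x -> rigid x s ->
    act (val (aut_fun phi s)) (y :: v) = y :: v.
  move=> yx sx; have [tau' _ tauK] := injF_bij tau_inj.
  rewrite -(tauK y); apply: below => s' s'x; apply: rigid_commute sx s'x => E.
  by apply: yx; rewrite E tauK.
exists tau => x d d1; split=> [y|dx].
  (* If the image of d moved tau z, it would conjugate the image of r z to an
     element moving words below another letter; but this conjugate is the image
     of the element r z ^ d, which is rigid at z as well. *)
  have [tau' _ tauK] := injF_bij tau_inj; rewrite -(tauK y); move: (tau' y) => z.
  apply: contrapT => /out zz; have [u] := tauP z; apply.
  apply: (@act_inj (val (aut_fun phi d))).
  have [_ _ /rigidJ/(_ d1)/zz E] := rP z.
  have := E (act (sec (val (aut_fun phi d)) (tau z)) u).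
  by rewrite aut_funJ -act_cons -actM /= mulVKg.
apply/val_inj/actP => v /=.
have := below x d (fun s sx => rigid_commute_sec sx d1 dx) v.
by rewrite act_cons => -[].
Qed.

(** * Descent of automorphisms to sections *)

(** The map f is what phi induces from sections at x to sections at y.  It is an
    arbitrary function at first, because bijectivity follows formally from
    existence for all phi and from [descends_comp]. *)
Definition descends phi x y (f : GT -> GT) := forall d, stab1 (val d) ->
  stab1 (val (aut_fun phi d)) /\ subsec (aut_fun phi d) y = f (subsec d x).

Lemma subsecM d e x : stab1 (val d) -> subsec (d * e) x = subsec d x * subsec e x.
Proof. by move=> d1; apply: val_inj; rewrite /= sec_stab1M. Qed.
Lemma subsecV d x : stab1 (val d) -> subsec d^-1 x = (subsec d x)^-1.
Proof. by move=> d1; apply: val_inj; rewrite /= sec_stab1V. Qed.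

Lemma subsec1 x : subsec 1 x = 1.
Proof. by apply: val_inj; rewrite /= sec1. Qed.

Lemma descends_ex phi x : exists y f, descends phi x y f.
Proof.
have [tau tauP] := aut_permutes_rigid phi.
have [l lP] := choice (fun g => let: ex_intro2 d d1 dx := subsec_lift g x in
  ex_intro (fun d => stab1 (val d) /\ subsec d x = g) d (conj d1 dx)).
exists (tau x), (fun g => subsec (aut_fun phi (l g)) (tau x)) => d d1.
have [pd1 _] := tauP x d d1; split=> //.
have [l1 lE] := lP (subsec d x); have [pl1 _] := tauP x _ l1.
(* The lift of the section of d and d itself differ by an element with trivial
   section at x, which phi sends to one with trivial section at tau x. *)
set e := l (subsec d x) in l1 lE pl1 *.
have [|_] := tauP x (e^-1 * d); first exact/stab1M/d1/stab1V.
rewrite subsecM ?subsecV ?lE ?mulVg //; last exact: stab1V.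
move=> /(_ erefl); rewrite aut_funM aut_funV subsecM ?subsecV //; last first.
  exact: stab1V.
by move=> E; apply: (mulgI (subsec (aut_fun phi e) (tau x))^-1); rewrite mulVg.
Qed.

Lemma descends_comp phi psi x y z f f' : descends phi x y f ->
  descends psi y z f' -> descends (phi * psi) x z (f' \o f).
Proof.
move=> Hf Hf' d d1; have [e1 eE] := Hf d d1; have [e1' eE'] := Hf' _ e1.
by rewrite aut_fun_comp; split=> //; rewrite eE' eE.
Qed.

(** An element of the rigid stabiliser of z has trivial section at every other
    letter x, but a nontrivial one at z. *)
Lemma descends_id x z f : descends 1 x z f -> z = x /\ f =1 id.
Proof.
move=> Hf; have f1 : f 1 = 1.
  by have [_] := Hf 1 (fun=> erefl); rewrite aut_fun1 !subsec1.
have zx : z = x.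
  apply: contrapT => zx; have [r [r1 rf rz]] := rigid_neq1 z; apply: r1.
  have [_] := Hf r rf; rewrite aut_fun_one (_ : subsec r x = 1) ?f1; last first.
    by apply/val_inj/actP => v; have := rz x v (nesym zx); rewrite act_cons => -[].
  move/(congr1 val)=> /= rz1; apply/val_inj/actP => -[|y v].
    by rewrite act_nil.
  have [->|/eqP/rz->//] := eqVneq y z.
  by rewrite act_cons rf rz1.
split=> // g; have [d d1 <-] := subsec_lift g x.
by have [_ <-] := Hf d d1; rewrite zx.
Qed.

(** Both candidates are two-sided inverses of what the inverse of phi induces. *)
Lemma descends_uniq phi x y y' f f' :
  descends phi x y f -> descends phi x y' f' -> y = y' /\ f =1 f'.
Proof.
move=> Hf Hf'; have [z [g Hg]] := descends_ex phi^-1 y.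
have := descends_comp Hf Hg; rewrite mulgV => /descends_id[zx gf].
rewrite {}zx in Hg.
have := descends_comp Hg Hf'; rewrite mulVg => /descends_id[yy fg].
by split=> // h; rewrite -[in LHS](fg (f h)) /= -[g (f h)]/((g \o f) h) gf.
Qed.

Lemma descends_aut phi x :
  exists p : 'I_4 * group_aut GT, descends phi x p.1 (aut_fun p.2).
Proof.
have [y [f Hf]] := descends_ex phi x; have [z [g Hg]] := descends_ex phi^-1 y.
have := descends_comp Hf Hg; rewrite mulgV => /descends_id[zx gf].
rewrite {}zx in Hg.
have := descends_comp Hg Hf; rewrite mulVg => /descends_id[_ fg].
have fM : {morph f : h k / h * k}.
  move=> h k; have [d d1 <-] := subsec_lift h x; have [e e1 <-] := subsec_lift k x.
  have [de1 dee] := Hf _ (stab1M d1 e1 : stab1 (val (d * e))).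
  have [pd1 <-] := Hf _ d1; have [pe1 <-] := Hf _ e1.
  by rewrite -subsecM // -dee aut_funM subsecM.
have fb : bijective f by exists g.
by exists (y, aut_of fb fM).
Qed.

Definition descent phi x := projT1 (cid (descends_aut phi x)).

Lemma descentP phi x :
  descends phi x (descent phi x).1 (aut_fun (descent phi x).2).
Proof. exact: (projT2 (cid (descends_aut phi x))). Qed.

Lemma descent_uniq phi x y psi :
  descends phi x y (aut_fun psi) -> descent phi x = (y, psi).
Proof.
move=> /(descends_uniq (descentP phi x)).
by case: (descent phi x) => y' psi' /= [-> E]; rewrite (aut_funP E).
Qed.

(** * The tree automorphism attached to an automorphism *)

Fixpoint aut_act phi (w : word) : word :=
  if w is x :: v then (descent phi x).1 :: aut_act (descent phi x).2 v else [::].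

Lemma aut_actM phi psi w : aut_act (phi * psi) w = aut_act psi (aut_act phi w).
Proof.
elim: w phi psi => //= x v IHv phi psi.
rewrite (@descent_uniq _ _ (descent psi (descent phi x).1).1
  ((descent phi x).2 * (descent psi (descent phi x).1).2)) /= ?IHv //.
exact: descends_comp (descentP _ _) (descentP _ _).
Qed.

Lemma G_normaliser g : val g \in normaliser G.
Proof.
apply/normaliserP => k; apply/idP/idP => [|kG]; last exact/gpredJ/(valP g).
move=> kG; rewrite -(conjgK (val g) k); apply: gpredJ => //.
by rewrite gpredV (valP g).
Qed.

Definition inner g : group_aut GT := conj_aut G (Sub (val g) (G_normaliser g)).

Lemma aut_fun_inner g h : aut_fun (inner g) h = h ^ g.
Proof. exact: val_inj. Qed.

Lemma descent_inner g x :
  descent (inner g) x = (letter (val g) x, inner (subsec g x)).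
Proof.
apply: descent_uniq => d d1; rewrite !aut_fun_inner; split; first exact: stab1J.
by apply: val_inj; rewrite /= /conjg !secM letterK secV d1.
Qed.

Lemma aut_act_inner g w : aut_act (inner g) w = act (val g) w.
Proof.
elim: w g => [|x v IHv] g; first by rewrite act_nil.
by rewrite /= descent_inner /= IHv act_cons.
Qed.

Lemma aut_act1 w : aut_act 1 w = w.
Proof.
rewrite (_ : 1 = inner 1) ?aut_act_inner //.
by apply: aut_funP => h; rewrite aut_fun_inner conjg1.
Qed.

Lemma aut_act_bij phi : bijective (aut_act phi).
Proof.
by exists (aut_act phi^-1) => w; rewrite -aut_actM ?mulgV ?mulVg aut_act1.
Qed.

Lemma aut_act_tree phi : Sym (aut_act_bij phi) \in tree_aut_pred.
Proof.
apply: tree_autE; rewrite /sym_fun /=.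
  by move=> u; elim: u phi => //= x u IHu phi; rewrite IHu.
move=> u v; elim: u phi => [|x u IHu] phi /=; first by exists (aut_act phi v).
by have [w ->] := IHu (descent phi x).2; exists w.
Qed.

Definition aut_tree phi : tree_aut :=
  Sub (Sym (aut_act_bij phi)) (aut_act_tree phi).

Lemma aut_treeM phi psi : aut_tree (phi * psi) = aut_tree phi * aut_tree psi.
Proof. by apply: actP => w; exact: aut_actM. Qed.

Lemma aut_treeV phi : aut_tree phi^-1 = (aut_tree phi)^-1.
Proof.
apply: (mulgI (aut_tree phi)); rewrite mulgV -aut_treeM mulgV.
by apply: actP => w; exact: aut_act1.
Qed.

Lemma aut_tree_inner g : aut_tree (inner g) = val g.
Proof. by apply: actP => w; exact: aut_act_inner. Qed.

(** Conjugation by g followed by phi is phi followed by conjugation by phi(g);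
    apply the homomorphism [aut_tree] to this identity. *)
Lemma aut_treeJ phi g : val g ^ aut_tree phi = val (aut_fun phi g).
Proof.
rewrite -!aut_tree_inner /conjg -aut_treeV -!aut_treeM; congr aut_tree.
by apply: aut_funP => h; rewrite !aut_fun_comp !aut_fun_inner aut_funJ aut_funVK.
Qed.

Lemma aut_tree_norm phi : aut_tree phi \in normaliser G.
Proof.
have stable psi (k : tree_aut) : k \in G -> k ^ aut_tree psi \in G.
  move=> kG; pose g : GT := Sub k kG.
  by have := valP (aut_fun psi g); rewrite -aut_treeJ.
apply/normaliserP => k; apply/idP/idP => [kG|]; last exact: stable.
by rewrite -(conjgK (aut_tree phi) k) -aut_treeV stable.
Qed.

Lemma conj_aut_inj : injective (conj_aut G).
Proof.
move=> h k hk; apply/val_inj/divg1_eq.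
have a1 : a <> 1 by move/(congr1 (fun f => act f [:: ord0])).
apply: (centraliser_trivial a1) => g gG.
have agG : a ^ g \in G by rewrite gpredJ.
pose c0 : GT := Sub (a ^ g) agG.
have := congr1 (fun phi => val (aut_fun phi c0)) hk => /= E.
apply: commute_sym; rewrite /commute.
move: (a ^ g) E => c E; have /= {}E : c ^ val h = c ^ val k := E.
by rewrite (conjgC c) conjgM E conjgK.
Qed.

Lemma conj_aut_surj phi : exists h : norm_of G, conj_aut G h = phi.
Proof.
exists (Sub (aut_tree phi) (aut_tree_norm phi)).
by apply: aut_funP => g; apply: val_inj; exact: aut_treeJ.
Qed.

Theorem proposition2 :
  super_strongly_fractal grigorchuk2 /\ bijective (conj_aut grigorchuk2).
Proof.
split; first exact: grigorchuk2_ssf.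
have [h hP] := choice conj_aut_surj.
by exists h => [k|phi]; rewrite ?hP //; apply: conj_aut_inj; rewrite hP.
Qed.
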